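(* Let $\alpha\in(0,1)$, $\kappa,\varepsilon>0$. If the maximum time step $\tau_{\max}=\max_{1\le k\le N}\tau_k$ satisfies $$\tau_{\max}\le\left(\frac{(2-\alpha+2\rho_n)h^2}{12\,\kappa\,(1+\rho_n)\,\Gamma(3-\alpha)}\right)^{1/\alpha}\quad\text{for all }1\le n\le N,$$ then the nonlinear difference scheme $$\mathscr A D^\alpha_\tau u_i^n=\kappa\,\delta_x^2 f(u_i^n)+\kappa\varepsilon^2\delta_x^2v_i^n,\qquad \mathscr A v_i^n=-\delta_x^2u_i^n,\qquad 1\le i\le M-1,\ 1\le n\le N,$$ $$u_i^0=u_0(x_i),\qquad 1\le i\le M-1,$$ with $f(u)=u^3-u$, has a unique solution $(u^n,v^n)_{1\le n\le N}$ with $u^n,v^n\in\mathring{\mathcal U}_h$.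
   Context: Space mesh: $M$ a positive integer, $h=(b-a)/M$, $x_i=a+ih$; $\mathring{\mathcal U}_h$ is the space of real mesh functions $u=(u_0,\dots,u_M)$ with $u_0=u_M=0$. For $1\le i\le M-1$: $\delta_x^2u_i=(u_{i-1}-2u_i+u_{i+1})/h^2$ and $\mathscr A u_i=\frac1{12}(u_{i-1}+10u_i+u_{i+1})$; $\mathscr A u_i=u_i$ for $i=0,M$. $u_0(\cdot)$ is a given initial function, whose mesh restriction lies in $\mathring{\mathcal U}_h$; $f$ acts componentwise. Time mesh: $0=t_0<\dots<t_N=T$, $\tau_k=t_k-t_{k-1}$, $\rho_1:=0$, $\rho_k=\tau_k/\tau_{k-1}\ge1$ for $2\le k\le N$; $\nabla_\tau w^k=w^k-w^{k-1}$. For $1\le k\le n$, $$c^{(n)}_{n-k}=\frac{(t_n-t_{k-1})^{1-\alpha}-(t_n-t_k)^{1-\alpha}}{\tau_k\Gamma(2-\alpha)},$$ $$d^{(n)}_{n-k}=\frac{2[(t_n-t_{k-1})^{2-\alpha}-(t_n-t_k)^{2-\alpha}]}{\tau_k^2\Gamma(3-\alpha)}-\frac{(t_n-t_{k-1})^{1-\alpha}+(t_n-t_k)^{1-\alpha}}{\tau_k\Gamma(2-\alpha)}.$$ Discrete (L2) Caputo derivative: $D^\alpha_\tau w^1=c^{(1)}_0\nabla_\tau w^1$ and, for $n\ge2$, $$D^\alpha_\tau w^n=\sum_{k=1}^n c^{(n)}_{n-k}\nabla_\tau w^k+\frac{\rho_n}{1+\rho_n}d^{(n)}_0\left[\nabla_\tau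 w^n-\rho_n\nabla_\tau w^{n-1}\right]+\sum_{k=1}^{n-1}d^{(n)}_{n-k}\frac{\nabla_\tau w^{k+1}-\rho_{k+1}\nabla_\tau w^k}{\rho_{k+1}(1+\rho_{k+1})}.$$ *)

(* Defs.v *)
From mathcomp Require Import all_boot all_order all_algebra.
From mathcomp Require Import all_classical all_reals all_analysis.

Set Implicit Arguments.
Unset Strict Implicit.
Unset Printing Implicit Defensive.

Import Order.TTheory GRing.Theory Num.Theory.

Local Open Scope ring_scope.

(* Euler's Gamma function, meant for s > 0 (where the integral is finite). *)
Definition Gamma (R : realType) (s : R) : R :=
  \int[lebesgue_measure]_(x in `]0, +oo[%classic) (x `^ (s - 1) * expR (- x)).

Section SpaceMesh.
Variables (R : realType) (M : nat).

Definition mesh_step (a b : R) : R := (b - a) / M%:R.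

Definition mesh_point (a b : R) (i : nat) : R := a + i%:R * mesh_step a b.

(* A mesh function (w_0, ..., w_M) is a row vector of length M + 1. *)
Definition mesh_restrict (a b : R) (g : R -> R) : 'rV[R]_M.+1 :=
  \row_i g (mesh_point a b i).

Definition zero_boundary (w : 'rV[R]_M.+1) : Prop :=
  w 0 ord0 = 0 /\ w 0 ord_max = 0.

Definition interior_node (i : 'I_M.+1) : bool := (1 <= i <= M - 1)%N.

(* Only used at interior nodes, where both neighbours are valid indices. *)
Definition delta2x (h : R) (w : 'rV[R]_M.+1) (i : 'I_M.+1) : R :=
  (w 0 (inord i.-1) - 2 * w 0 i + w 0 (inord i.+1)) / h ^+ 2.

Definition compact_avg (w : 'rV[R]_M.+1) (i : 'I_M.+1) : R :=
  if interior_node i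
  then 12^-1 * (w 0 (inord i.-1) + 10 * w 0 i + w 0 (inord i.+1))
  else w 0 i.

End SpaceMesh.

(* Time levels t_0, ..., t_N are the values of t : nat -> R at 0, ..., N;
   values of t, and of sequences of mesh functions, beyond N are irrelevant. *)
Section TimeMesh.
Variables (R : realType) (alpha : R) (t : nat -> R).

Definition tau (k : nat) : R := t k - t k.-1.

Definition rho (k : nat) : R := if k == 1%N then 0 else tau k / tau k.-1.

Definition tau_max (N : nat) : R := \big[Num.max/0]_(1 <= k < N.+1) tau k.

(* [coef_c n j] and [coef_d n j] are $c^{(n)}_j$ and $d^{(n)}_j$, the index
   being j = n - k with 1 <= k <= n. *)
Definition coef_c (n j : nat) : R :=
  let k := (n - j)%N in
  ((t n - t k.-1) `^ (1 - alpha) - (t n - t k) `^ (1 - alpha))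
  / (tau k * Gamma (2 - alpha)).

Definition coef_d (n j : nat) : R :=
  let k := (n - j)%N in
  2 * ((t n - t k.-1) `^ (2 - alpha) - (t n - t k) `^ (2 - alpha))
    / (tau k ^+ 2 * Gamma (3 - alpha))
  - ((t n - t k.-1) `^ (1 - alpha) + (t n - t k) `^ (1 - alpha))
    / (tau k * Gamma (2 - alpha)).

Definition nabla (V : lmodType R) (w : nat -> V) (k : nat) : V :=
  w k - w k.-1.

Definition caputo (V : lmodType R) (w : nat -> V) (n : nat) : V :=
  if n == 1%N then coef_c 1 0 *: nabla w 1
  else
    \sum_(1 <= k < n.+1) coef_c n (n - k) *: nabla w k
    + (rho n / (1 + rho n) * coef_d n 0)
        *: (nabla w n - rho n *: nabla w n.-1)
    + \sum_(1 <= k < n)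
        (coef_d n (n - k) / (rho k.+1 * (1 + rho k.+1)))
          *: (nabla w k.+1 - rho k.+1 *: nabla w k).

End TimeMesh.

Definition f_CH (R : realType) (x : R) : R := x ^+ 3 - x.

(* (u, v) solves the scheme; v 0 is not constrained. *)
Definition scheme_solution (R : realType) (M N : nat)
    (alpha kappa eps a b : R) (t : nat -> R) (u0 : R -> R)
    (u v : nat -> 'rV[R]_M.+1) : Prop :=
  let h := mesh_step M a b in
  [/\ (forall n, (n <= N)%N -> zero_boundary (u n)),
      (forall n, (1 <= n <= N)%N -> zero_boundary (v n)),
      (forall i, interior_node i -> u 0%N 0 i = u0 (mesh_point M a b i)),
      (forall n i, (1 <= n <= N)%N -> interior_node i ->
        compact_avg (caputo alpha t u n) i
        = kappa * delta2x h (map_mx (@f_CH R) (u n)) i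
          + kappa * eps ^+ 2 * delta2x h (v n) i)
    & (forall n i, (1 <= n <= N)%N -> interior_node i ->
        compact_avg (v n) i = - delta2x h (u n) i)].

(* Main.v *)
(** Write [L = - delta_x^2] on interior values and [A = 1 - (h^2/12) L] for the
    compact average.  Eliminating [v = A^-1 L u] and applying [L^-1], each time
    level becomes [P u + kappa u^3 = g], where
    [P = beta L^-1 A - kappa + kappa eps^2 A^-1 L] and [beta] is the coefficient
    of [u^n] in the discrete Caputo derivative.  Since [L <= 4/h^2], one has
    [L^-1 A >= h^2/6], and the step restriction gives [beta h^2/12 >= kappa];
    hence [P] is symmetric and nonnegative, the system is the Euler equation of
    a coercive quartic energy, and its left-hand side is strictly monotone. *)

From HB Require Import structures.
Require Import Defs.
From mathcomp Require Import all_boot all_order all_algebra.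
From mathcomp Require Import all_classical all_reals all_analysis.
From mathcomp Require Import measurable_realfun ring lra.

Set Implicit Arguments.
Unset Strict Implicit.
Unset Printing Implicit Defensive.

Import Order.TTheory GRing.Theory Num.Theory.
Import numFieldNormedType.Exports.

Local Open Scope ring_scope.

(** * The Gamma function *)

(** Applying [L^-1] makes the cubic term diagonal, hence both monotone and the gradient of a
    separable quartic for the Euclidean product; behind [L] it is neither in general. The price is
    the term [- kappa], left over from the linear part of [f], which the leading time coefficient
    has to absorb. That coefficient is [c_0 + rho/(1+rho) d_0 + d_1/(rho(1+rho))] for n >= 2. Its
    first two terms add up exactly to the quotient behind the step restriction, and [d_1] is
    nonnegative because it measures the error of the trapezoidal rule for the concave function
    [z^(1-alpha)]. The exact sum rests on [Gamma(3-alpha) = (2-alpha) Gamma(2-alpha)], which has to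
    be derived from the integral by integration by parts. The bound on [L] is used as the quadratic
    form inequality [L^2 <= (4/h^2) L], so no eigenvectors appear. Earlier levels enter only through
    [g], so one level is solved for arbitrary [g]. *)

Lemma powR_le_1Dsqr (R : realType) (x p : R) :
  0 <= x -> 0 <= p <= 2 -> x `^ p <= 1 + x ^+ 2.
Proof.
move=> x0 /andP[p0 p2]; have [x1|x1] := leP x 1.
  rewrite (@le_trans _ _ 1) ?lerDl ?sqr_ge0//.
  have [->|px] := eqVneq x 0; first by rewrite /powR eqxx lern1 leq_b1.
  rewrite -(powRr0 x); apply: ger_powR => //.
  by rewrite lt_neqAle eq_sym px x0.
rewrite (@le_trans _ _ (x `^ 2%:R))//; first by apply: ler_powR => //; exact: ltW.
by rewrite powR_mulrn// lerDr.
Qed.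

(** The constant comes from [(1 + x/4)^2 <= exp(x/2)], whose quadratic coefficient is 1/16. The
    bound gives integrability and decay at infinity at once. *)
Lemma powR_expRN_le (R : realType) (x p : R) : 0 <= x -> 0 <= p <= 2 ->
  x `^ p * expR (- x) <= 16 * expR (- (x / 2)).
Proof.
move=> x0 hp.
have e0 := expR_gt0 (- (x / 2)).
rewrite (_ : - x = - (x / 2) - (x / 2)); last by field.
rewrite expRD mulrA ler_pM2r// expRN ler_pdivrMr ?expR_gt0//.
apply: (le_trans (powR_le_1Dsqr x0 hp)).
have -> : x / 2 = x / 4 + x / 4 by field.
rewrite expRD.
have : 1 + x / 4 <= expR (x / 4) by exact: expR_ge1Dx.
set y := expR _ => hy; nra.
Qed.

Section GammaIntegral.
Local Open Scope classical_set_scope.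
Variable R : realType.
Notation mu := (@lebesgue_measure R).
Implicit Types s p x : R.

Let g p x := x `^ p * expR (- x).

Let measurable_g p (D : set R) : measurable D -> measurable_fun D (g p).
Proof.
move=> mD; apply: measurable_funM.
  by apply: measurable_funTS; exact: measurable_powR.
by apply: measurable_funTS; apply: measurableT_comp => //; exact: measurable_funN.
Qed.

Let g_ge0 p x : 0 <= g p x.
Proof. by rewrite mulr_ge0 ?powR_ge0 ?expR_ge0. Qed.

Let is_derive_g p x : 0 < x ->
  is_derive x 1 (g p) (p * x `^ (p - 1) * expR (- x) - g p x).
Proof.
move=> x0; have hp := is_derive1_powR p x0.
apply: is_derive_eq; rewrite /g/= /GRing.scale/=; ring.
Qed.

Let is_derive_expRN_half x :
  is_derive x 1 (fun y => expR (- (y / 2))) (- (expR (- (x / 2)) / 2)).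
Proof. by apply: is_derive_eq; rewrite /GRing.scale/=; ring. Qed.

Let continuous_expRN_half : continuous (fun x : R => expR (- (x / 2))).
Proof.
move=> x; apply: differentiable_continuous; apply/derivable1_diffP.
by have [] := is_derive_expRN_half x.
Qed.

Let cvg_expRN_half : expR (- (x / 2)) @[x --> +oo] --> (0 : R).
Proof.
apply: (@cvg_comp _ _ _ (fun x : R => x / 2) (fun y => expR (- y)) _ +oo).
  apply: gt0_cvgMly => //.
exact: cvgr_expR.
Qed.

Let cvg_g p : 0 <= p <= 2 -> g p x @[x --> +oo] --> 0.
Proof.
move=> hp.
apply: (@squeeze_cvgr _ _ _ _ (cst 0) (fun x => 16 * expR (- (x / 2)))).
- by near=> x; rewrite g_ge0/= powR_expRN_le.
- exact: cvg_cst.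
- by rewrite -(mulr0 16); apply: cvgMl_tmp; exact: cvg_expRN_half.
Unshelve. end_near. Qed.

Let continuous_g p x : 0 < x -> {for x, continuous (g p)}.
Proof.
move=> x0; apply: differentiable_continuous; apply/derivable1_diffP.
by have := is_derive_g p x0 => -[].
Qed.

Let cvg_g0 p : 0 < p -> g p x @[x --> 0^'+] --> (0 : R).
Proof.
move=> p0; rewrite -[X in _ --> X](mul0r (expR (- 0))).
apply: cvgM; first exact: powR_cvg0.
apply: cvg_at_right_filter; apply: continuous_comp; first exact: opp_continuous.
exact: continuous_expR.
Qed.

Let I p : \bar R := (\int[mu]_(x in `]0%R, +oo[) (g p x)%:E)%E.

Let measurable_expRN_half (D : set R) : measurable D ->
  measurable_fun D (fun x : R => expR (- (x / 2))).
Proof.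
move=> mD; apply: measurable_funTS; apply: measurableT_comp => //.
by apply: measurable_funN; apply: measurable_funM.
Qed.

Let integral_expRN_half c : 0 <= c ->
  (\int[mu]_(x in `]0%R, +oo[) (c * expR (- (x / 2)))%:E = (2 * c)%:E)%E.
Proof.
move=> c0; rewrite integral_itv_obnd_cbnd; last first.
  apply/measurable_EFinP; apply: measurable_funM => //.
  exact: measurable_expRN_half.
have dF x : is_derive x 1 (fun y => - (2 * c) * expR (- (y / 2)))
    (c * expR (- (x / 2))).
  have h := is_derive_expRN_half x.
  by apply: is_derive_eq; rewrite /GRing.scale/=; field.
have cF x : {for x, continuous (fun y : R => - (2 * c) * expR (- (y / 2)))}.
  apply: differentiable_continuous; apply/derivable1_diffP.
  by have [] := dF x.
rewrite (@ge0_continuous_FTC2y _ _ (fun x => - (2 * c) * expR (- (x / 2))) _ 0).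
- by rewrite mul0r oppr0 expR0 mulr1 EFinN oppeK add0e.
- by move=> x x0; rewrite mulr_ge0 ?expR_ge0.
- apply: continuous_subspaceT => x; apply: cvgMl_tmp.
  exact: continuous_expRN_half.
- by rewrite -(mulr0 (- (2 * c))); apply: cvgMl_tmp; exact: cvg_expRN_half.
- by move=> x _; have [] := dF x.
- by apply: cvg_at_right_filter; exact: cF.
- by move=> x _; rewrite derive1E; have [_ ->] := dF x.
Qed.

(* [16 exp(-x/2)] dominates [x^s exp(-x)], so adding it to the derivative of
   the latter gives a nonnegative function, as the improper FTC requires. *)
Let I_rec s : 1 < s -> s <= 2 -> I s = (s%:E * I (s - 1))%E.
Proof.
move=> s1 s2.
have s0 : 0 < s by lra.
pose q x := s * g (s - 1) x - g s x + 16 * expR (- (x / 2)).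
have q0 x : 0 <= x -> 0 <= q x.
  move=> x0; rewrite /q.
  have : g s x <= 16 * expR (- (x / 2)) by apply: powR_expRN_le => //; lra.
  have : 0 <= s * g (s - 1) x by rewrite mulr_ge0 ?g_ge0// ltW.
  lra.
have mq (D : set R) : measurable D -> measurable_fun D q.
  move=> mD'; apply: measurable_funD; last first.
    by apply: measurable_funM => //; exact: measurable_expRN_half.
  apply: measurable_funB; last exact: measurable_g.
  by apply: measurable_funM => //; exact: measurable_g.
have Iq : (\int[mu]_(x in `]0%R, +oo[) (q x)%:E = 32%:E)%E.
  rewrite integral_itv_obnd_cbnd; last by apply/measurable_EFinP; exact: mq.
  have dF x : 0 < x ->
      is_derive x 1 (fun y => g s y - 32 * expR (- (y / 2))) (q x).
    move=> x0; have h1 := is_derive_g s x0.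
    have h2 := is_derive_expRN_half x.
    by apply: is_derive_eq; rewrite /q /g /GRing.scale/=; field.
  have half : continuous (fun x : R => 16 * expR (- (x / 2))).
    by move=> x; apply: cvgMl_tmp; exact: continuous_expRN_half.
  rewrite (@ge0_continuous_FTC2y _ _ (fun x => g s x - 32 * expR (- (x / 2))) _ 0).
  - rewrite /g powR0 ?gt_eqF// !mul0r oppr0 expR0 mulr1 sub0r.
    by rewrite -EFinN opprK add0e.
  - exact: q0.
  - apply/continuous_within_itvcyP; split.
      move=> x; rewrite in_itv/= andbT => x0.
      apply: cvgD; last exact: half.
      by apply: cvgB; [apply: cvgMl_tmp|]; exact: continuous_g.
    (* Continuity up to 0 depends on [s - 1] being positive: then [0]^ (s - 1)[is 0, whereas]0 [^ 0]
       is 1. *)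
    have -> : q 0 = s * 0 - 0 + 16 * expR (- (0 / 2)).
      by rewrite /q /g !powR0 ?mul0r ?subr_eq0 ?gt_eqF.
    have s10 : 0 < s - 1 by rewrite subr_gt0.
    exact: (cvgD (cvgB (cvgM (cvg_cst s) (cvg_g0 s10)) (cvg_g0 s0))
      (cvg_at_right_filter (half 0))).
  - rewrite -(subr0 0); apply: cvgB; first by apply: cvg_g; lra.
    by rewrite -(mulr0 32); apply: cvgMl_tmp; exact: cvg_expRN_half.
  - by move=> x x0; have [] := dF x x0.
  - have -> : g s 0 = 0 by rewrite /g powR0 ?mul0r ?gt_eqF.
    apply: cvgB; first exact: cvg_g0.
    apply: cvg_at_right_filter; apply: cvgMl_tmp.
    exact: continuous_expRN_half.
  - by move=> x; rewrite in_itv/= andbT => x0; rewrite derive1E; have [_ ->] := dF x x0.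
(* The nonnegative function [g s + q] is integrated in two ways, since it also equals
   [s * g (s - 1) + 16 exp(-x/2)]; cancelling the finite 32 leaves the recursion. *)
have E1 : (I s + 32%:E =
    \int[mu]_(x in `]0%R, +oo[) (g s x + q x)%:E)%E.
  under eq_integral do rewrite EFinD.
  rewrite ge0_integralD//.
  - by rewrite Iq.
  - by move=> x _; rewrite lee_fin g_ge0.
  - by apply/measurable_EFinP; exact: measurable_g.
  - by move=> x /=; rewrite in_itv/= andbT => x0; rewrite lee_fin q0// ltW.
  - by apply/measurable_EFinP; exact: mq.
have E2 : (s%:E * I (s - 1) + 32%:E =
    \int[mu]_(x in `]0%R, +oo[) (g s x + q x)%:E)%E.
  under eq_integral.
    move=> x _; rewrite (_ : g s x + q x =
      s * g (s - 1) x + 16 * expR (- (x / 2))); last by rewrite /q; ring.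
    rewrite EFinD; over.
  rewrite ge0_integralD//.
  - rewrite integral_expRN_half//; congr (_ + _)%E; last by congr EFin; ring.
    under eq_integral do rewrite EFinM.
    rewrite ge0_integralZl_EFin ?ltW//.
    - by move=> x _; rewrite lee_fin g_ge0.
    - by apply/measurable_EFinP; exact: measurable_g.
  - by move=> x _; rewrite lee_fin mulr_ge0 ?g_ge0// ltW.
  - by apply/measurable_EFinP; apply: measurable_funM => //; exact: measurable_g.
  - apply/measurable_EFinP; apply: measurable_funM => //.
    exact: measurable_expRN_half.
by move: E1; rewrite -E2 => /(congr1 (fun y => y - 32%:E)%E); rewrite !addeK.
Qed.

Let I_lty p : 0 <= p <= 2 -> (I p < +oo)%E.
Proof.
move=> hp; apply: (@le_lt_trans _ _
  (\int[mu]_(x in `]0%R, +oo[) (16 * expR (- (x / 2)))%:E)%E).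
  apply: ge0_le_integral => //.
  - by move=> x _; rewrite lee_fin g_ge0.
  - by apply/measurable_EFinP; exact: measurable_g.
  - apply/measurable_EFinP; apply: measurable_funM => //.
    exact: measurable_expRN_half.
  - move=> x /=; rewrite in_itv/= andbT => x0; rewrite lee_fin.
    by apply: powR_expRN_le => //; exact: ltW.
by rewrite integral_expRN_half ?ltry.
Qed.

Let I_gt0 p : 0 <= p -> (0 < I p)%E.
Proof.
move=> p0; apply: (@lt_le_trans _ _ (\int[mu]_(x in `[1%R, 2%R]) (expR (- 2))%:E)%E).
  rewrite integral_cst//= lebesgue_measure_itv/= lte_fin ltr1n -EFinD -EFinM lte_fin.
  by rewrite mulr_gt0 ?expR_gt0//; lra.
apply: (@le_trans _ _ (\int[mu]_(x in `[1%R, 2%R]) (g p x)%:E)%E).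
  apply: ge0_le_integral => //.
  - by apply/measurable_EFinP; exact: measurable_g.
  - move=> x /=; rewrite in_itv/= => /andP[x1 x2]; rewrite lee_fin.
    rewrite -[leLHS]mul1r; apply: ler_pM => //; rewrite ?expR_ge0//.
      by rewrite -(powRr0 x); exact: ler_powR.
    by rewrite ler_expR lerN2.
apply: ge0_subset_integral => //.
- by apply/measurable_EFinP; exact: measurable_g.
- by move=> x _; rewrite lee_fin g_ge0.
- by move=> x /=; rewrite !in_itv/= andbT => /andP[x1 _]; apply: lt_le_trans x1.
Qed.

Let GammaE s : Gamma s = fine (I (s - 1)).
Proof. by []. Qed.

(** The range matches the exponents [s - 1] in [0, 2] that are dominated above, and contains
    [2 - alpha] and [3 - alpha]. Finiteness matters too, because [fine] sends an infinite integral
    to 0. *)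
Lemma Gamma_gt0 s : 1 <= s -> s <= 3 -> 0 < Gamma s.
Proof.
move=> s1 s3; rewrite GammaE; apply: fine_gt0; rewrite I_gt0 ?I_lty//; lra.
Qed.

Lemma Gamma_succ s : 1 < s -> s <= 2 -> Gamma (s + 1) = s * Gamma s.
Proof.
move=> s1 s2; have sK : s + 1 - 1 = s by rewrite addrK.
rewrite (GammaE (s + 1)) (GammaE s) sK (I_rec s1 s2).
have s0 : 0 <= s - 1 by lra.
have s2' : 0 <= s - 1 <= 2 by lra.
by rewrite fineM// ge0_fin_numE ?I_lty// ltW// I_gt0.
Qed.

End GammaIntegral.

(** * Monotone cubic systems *)

Section CubicSystem.
Local Open Scope classical_set_scope.
Variables (R : realType) (m : nat).
Implicit Types (u w g : 'rV[R]_m) (P : 'M[R]_m).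

Definition dot u w : R := (u *m w^T) 0 0.

Lemma dotE u w : dot u w = \sum_i u 0 i * w 0 i.
Proof. by rewrite /dot mxE; apply: eq_bigr => i _; rewrite mxE. Qed.

Lemma dotC u w : dot u w = dot w u.
Proof. by rewrite !dotE; apply: eq_bigr => i _; rewrite mulrC. Qed.

Lemma dotDl u w g : dot (u + w) g = dot u g + dot w g.
Proof. by rewrite /dot mulmxDl mxE. Qed.

Lemma dotNl u g : dot (- u) g = - dot u g.
Proof. by rewrite /dot mulNmx mxE. Qed.

Lemma dot0l u : dot 0 u = 0.
Proof. by rewrite /dot mul0mx mxE. Qed.

Lemma dotBl u w g : dot (u - w) g = dot u g - dot w g.
Proof. by rewrite dotDl dotNl. Qed.

Lemma dotZl c u g : dot (c *: u) g = c * dot u g.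
Proof. by rewrite /dot -scalemxAl mxE. Qed.

Lemma dotDr u w g : dot g (u + w) = dot g u + dot g w.
Proof. by rewrite dotC dotDl !(dotC _ g). Qed.

Lemma dotZr c u g : dot g (c *: u) = c * dot g u.
Proof. by rewrite dotC dotZl (dotC _ g). Qed.

Lemma dot_mulmx_sym P u w : P^T = P -> dot (u *m P) w = dot u (w *m P).
Proof. by move=> Psym; rewrite /dot trmx_mul Psym mulmxA. Qed.

Lemma dot_ge0 u : 0 <= dot u u.
Proof. by rewrite dotE sumr_ge0// => i _; rewrite -expr2 sqr_ge0. Qed.

Lemma dot_eq0 u : dot u u = 0 -> u = 0.
Proof.
rewrite dotE => /psumr_eq0P u0; apply/rowP => i; rewrite mxE.
have u00 : u 0 i * u 0 i = 0 by apply: u0 => // j _; rewrite -expr2 sqr_ge0.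
by apply/eqP; have /eqP := u00; rewrite mulf_eq0 orbb.
Qed.

Definition cube u : 'rV[R]_m := map_mx (fun x => x ^+ 3) u.

(** Pairing the difference of the two equations with [u - w] gives two nonnegative terms of sum 0.
    As [P] may be degenerate, the conclusion is drawn from the cubic term. *)
Lemma cubic_system_inj P k g u w : (forall z, 0 <= dot (z *m P) z) -> 0 < k ->
  u *m P + k *: cube u = g -> w *m P + k *: cube w = g -> u = w.
Proof.
move=> Ppos k0 hu hw.
have : dot ((u *m P + k *: cube u) - (w *m P + k *: cube w)) (u - w) = 0.
  by rewrite hu hw subrr dot0l.
rewrite (_ : _ - _ = (u - w) *m P + k *: (cube u - cube w)); last first.
  by rewrite mulmxBl scalerBr opprD addrACA.
rewrite dotDl dotZl => h.
have mono (x y : R) : 0 <= (x ^+ 3 - y ^+ 3) * (x - y).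
  have -> : (x ^+ 3 - y ^+ 3) * (x - y) =
    (x - y) ^+ 2 * ((x + y / 2) ^+ 2 + 3 / 4 * y ^+ 2) by field.
  by rewrite mulr_ge0 ?sqr_ge0// addr_ge0 ?sqr_ge0// mulr_ge0 ?sqr_ge0//; lra.
have c0 : dot (cube u - cube w) (u - w) = 0.
  have p0 : 0 <= dot (cube u - cube w) (u - w).
    by rewrite dotE sumr_ge0// => i _; rewrite !mxE.
  have := Ppos (u - w); nra.
apply/rowP => i; move: c0; rewrite dotE => /psumr_eq0P ce.
have c0 : (u 0 i ^+ 3 - w 0 i ^+ 3) * (u 0 i - w 0 i) = 0.
  have : (cube u - cube w) 0 i * (u - w) 0 i = 0.
    by apply: ce => // j _; rewrite !mxE.
  by rewrite !mxE.
set x := u 0 i in c0 *; set y := w 0 i in c0 *.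
(* Quantitative strict monotonicity of the cube, from [4(x^2 + xy + y^2) - (x - y)^2 = 3(x +
   y)^2]. *)
have : (x - y) ^+ 4 <= 4 * ((x ^+ 3 - y ^+ 3) * (x - y)).
  rewrite -subr_ge0 (_ : _ - _ = 3 * (x - y) ^+ 2 * (x + y) ^+ 2); last by ring.
  by apply: mulr_ge0; [apply: mulr_ge0|]; rewrite ?sqr_ge0.
rewrite c0 mulr0 => h4.
have /eqP : (x - y) ^+ 4 = 0 by apply/eqP; rewrite eq_le h4 exprn_even_ge0.
by rewrite expf_eq0/= subr_eq0 => /eqP.
Qed.

(** For symmetric [P] its gradient is the residual [u *m P + k *: cube u - g]. *)
Definition cubic_energy P k g u : R :=
  2^-1 * dot (u *m P) u + k / 4 * (\sum_i u 0 i ^+ 4) - dot g u.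

Lemma continuous_cubic_energy P k g : continuous (cubic_energy P k g).
Proof.
have co i : continuous (fun u : 'rV[R]_m => u 0 i) by exact: coord_continuous.
have cs (F : 'I_m -> 'rV[R]_m -> R) : (forall i, continuous (F i)) ->
    continuous (fun u => \sum_i F i u).
  by move=> cF; apply: continuous_big => //; exact: add_continuous.
have cd (F G : 'rV[R]_m -> 'rV[R]_m) : (forall i, continuous (fun u => F u 0 i)) ->
    (forall i, continuous (fun u => G u 0 i)) -> continuous (fun u => dot (F u) (G u)).
  move=> cF cG.
  rewrite (_ : (fun u => _) = fun u => \sum_i F u 0 i * G u 0 i); last first.
    by apply/funext => u; rewrite dotE.
  by apply: cs => i u; exact: (cvgM (cF i u) (cG i u)).
have cP i : continuous (fun u : 'rV[R]_m => (u *m P) 0 i).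
  rewrite (_ : (fun u => _) = fun u : 'rV[R]_m => \sum_j u 0 j * P j i); last first.
    by apply/funext => u; rewrite mxE.
  by apply: cs => j u; exact: (cvgM (co j u) (cvg_cst _)).
have c1 : continuous (fun u => dot (u *m P) u) by exact: (cd (mulmxr P) id).
have c2 : continuous (fun u : 'rV[R]_m => \sum_i u 0 i ^+ 4).
  by apply: cs => i w; exact: (continuous_comp (@co i w) (@exprn_continuous _ 4 _)).
have c3 : continuous (fun u => dot g u).
  by apply: (cd (cst g) id) => // i; exact: cst_continuous.
move=> u; exact: (cvgB (cvgD (cvgM (cvg_cst _) (c1 u)) (cvgM (cvg_cst _) (c2 u)))
  (c3 u)).
Qed.

Lemma cubic_energyD P k g u i s : P^T = P ->
  cubic_energy P k g (u + s *: delta_mx 0 i) = cubic_energy P k g u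
  + s * ((u *m P) 0 i + k * u 0 i ^+ 3 - g 0 i)
  + s ^+ 2 * (2^-1 * P i i + 3 / 2 * k * u 0 i ^+ 2 + k * u 0 i * s + k / 4 * s ^+ 2).
Proof.
move=> Psym; rewrite /cubic_energy.
have dd w : dot w (delta_mx 0 i) = w 0 i.
  rewrite dotE (bigD1 i)//= mxE !eqxx mulr1 big1 ?addr0// => j ji.
  by rewrite mxE (negbTE ji) andbF mulr0.
have -> : dot ((u + s *: delta_mx 0 i) *m P) (u + s *: delta_mx 0 i) =
    dot (u *m P) u + 2 * s * (u *m P) 0 i + s ^+ 2 * P i i.
  rewrite mulmxDl dotDl !dotDr -scalemxAl !dotZl !dotZr.
  rewrite [dot (delta_mx 0 i *m P) u]dot_mulmx_sym// [dot (delta_mx _ _) _]dotC !dd.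
  by rewrite -rowE !mxE; ring.
have -> : \sum_j (u + s *: delta_mx 0 i) 0 j ^+ 4 =
    (\sum_j u 0 j ^+ 4) + ((u 0 i + s) ^+ 4 - u 0 i ^+ 4).
  rewrite (bigD1 i)//= [in RHS](bigD1 i)//= !mxE !eqxx mulr1.
  rewrite (eq_bigr (fun j => u 0 j ^+ 4)); first by ring.
  by move=> j ji; rewrite !mxE (negbTE ji) andbF mulr0 addr0.
by rewrite dotDr dotZr dd; field.
Qed.

(** First-order optimality without derivatives: at [s = - c / D] the expression is
    [(c / D)^2 (q s - D)]. The summand [|c|] of [D] keeps [|s| <= 1], and [1 + |Q|] makes [D] exceed
    [q s]. *)
Lemma linear_coef_eq0 (c Q : R) (q : R -> R) :
  (forall s, `|s| <= 1 -> q s <= Q) ->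
  (forall s, 0 <= s * c + s ^+ 2 * q s) -> c = 0.
Proof.
move=> hq h; apply/eqP; rewrite -normr_le0 leNgt; apply/negP => c0.
pose D := 1 + `|Q| + `|c|.
have D0 : 0 < D by rewrite /D; have := normr_ge0 Q; lra.
have hs : `|- (c / D)| <= 1.
  rewrite normrN normf_div (gtr0_norm D0) ler_pdivrMr// mul1r /D.
  by have := normr_ge0 Q; lra.
have := h (- (c / D)); have := hq _ hs.
set y := q _ => hy.
have : y < D by rewrite /D; have := ler_norm Q; lra.
move=> yD.
have -> : - (c / D) * c + (- (c / D)) ^+ 2 * y = (c / D) ^+ 2 * (y - D).
  by field; rewrite gt_eqF.
apply/negP; rewrite -ltNge nmulr_llt0; last by lra.
have c1 : c != 0 by rewrite -normr_gt0.
by rewrite exprn_even_gt0//= mulf_neq0// invr_eq0 gt_eqF.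
Qed.

(** The energy is minimised over a compact box. Outside the box the quartic term outweighs [dot g],
    so the energy is at least its value 0 at the origin and the minimum is global; perturbing one
    coordinate at a time then gives the system. *)
Lemma cubic_system_ex P k g :
  P^T = P -> (forall z, 0 <= dot (z *m P) z) -> 0 < k ->
  exists u, u *m P + k *: cube u = g.
Proof.
move=> Psym Ppos k0.
pose J := cubic_energy P k g.
pose S := \sum_i `|g 0 i|.
have S0 : 0 <= S by rewrite sumr_ge0.
(* If the largest entry has modulus [r >= B >= 1], then [k r^3 >= k r >= 4 S], hence
   [k/4 r^4 >= S r >= dot g w]. *)
pose B : R := 1 + 4 * S / k.
have B1 : 1 <= B by rewrite lerDl divr_ge0 ?mulr_ge0// ltW.
pose box := [set u : 'rV[R]_m | forall i, u 0 i \in `[- B, B]%R].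
have box0 : box 0 by move=> i /=; rewrite mxE in_itv/=; lra.
have J0 : J 0 = 0.
  rewrite /J /cubic_energy mul0mx dot0l mulr0 add0r dotC dot0l subr0.
  by rewrite big1 ?mulr0// => i _; rewrite mxE expr0n.
have [u ubox umin] : exists2 u, u \in box & forall w, w \in box -> J u <= J w.
  apply: EVT_min_rV; first by exists 0.
  - apply: (@rV_compact R _ (fun=> `[- B, B]%classic)) => i.
    exact: segment_compact.
  - by apply: continuous_subspaceT => w; exact: continuous_cubic_energy.
have Jout w : ~ box w -> 0 <= J w.
  move=> /existsNP[i0 hi0].
  have [j rmax] : exists j, forall l, `|w 0 l| <= `|w 0 j|.
    case: (@Order.TotalTheory.arg_maxP _ _ _ i0 xpredT (fun l => `|w 0 l|)) => //.
    by move=> j _ hj; exists j => l; exact: hj.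
  set r := `|w 0 j| in rmax.
  have rB : B <= r.
    apply: le_trans (rmax i0); rewrite leNgt; apply/negP => hlt.
    by apply: hi0; rewrite in_itv/= -ler_norml ltW.
  have h4 : r ^+ 4 <= \sum_i w 0 i ^+ 4.
    rewrite /r (bigD1 j)//= -normrX ger0_norm ?exprn_even_ge0// lerDl.
    by rewrite sumr_ge0// => l _; rewrite exprn_even_ge0.
  have h1 : dot g w <= S * r.
    rewrite dotE mulr_suml; apply: ler_sum => l _.
    rewrite (le_trans (ler_norm _))// normrM; apply: ler_wpM2l => //.
  have hk : 4 * S <= k * r ^+ 3.
    have : 4 * S = k * (B - 1) by rewrite /B; field; rewrite gt_eqF.
    move=> ->; rewrite ler_pM2l//.
    have : r <= r ^+ 3 by rewrite exprS -[leLHS]mulr1 ler_wpM2l ?exprn_ege1//; lra.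
    by lra.
  have := Ppos w; rewrite /J /cubic_energy.
  have : S * r <= k / 4 * r ^+ 4.
    rewrite (_ : k / 4 * r ^+ 4 = (k * r ^+ 3 / 4) * r); last by field.
    by rewrite ler_wpM2r//; lra.
  have : k / 4 * r ^+ 4 <= k / 4 * \sum_i w 0 i ^+ 4.
    by rewrite ler_wpM2l// divr_ge0// ltW.
  lra.
have gmin w : J u <= J w.
  have [wb|wb] := pselect (box w); first by apply: umin; rewrite inE.
  by rewrite (le_trans _ (Jout _ wb))// -J0; apply: umin; rewrite inE.
exists u; apply/rowP => i; apply/eqP; rewrite -subr_eq0; apply/eqP.
rewrite !mxE.
pose q s := 2^-1 * P i i + 3 / 2 * k * u 0 i ^+ 2 + k * u 0 i * s + k / 4 * s ^+ 2.
apply: (@linear_coef_eq0 _ (2^-1 * P i i + 3 / 2 * k * u 0 i ^+ 2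
    + `|k * u 0 i| + k / 4) q) => s.
- move=> s1; rewrite /q; apply: lerD.
    rewrite lerD2l (le_trans (ler_norm _))// normrM.
    by rewrite -[leRHS]mulr1 ler_wpM2l.
  rewrite -[leRHS]mulr1 ler_wpM2l ?divr_ge0 ?(ltW k0)//.
  by rewrite -real_normK ?num_real// expr_le1.
- have := gmin (u + s *: delta_mx 0 i).
  rewrite /J cubic_energyD// !mxE /q; lra.
Qed.

End CubicSystem.

(** * The discrete Laplacian *)

(** The boundary terms are kept so that induction on [m] goes through; they vanish once [W] is 0 at
    both ends. *)
Lemma sum_parts (R : comRingType) (U W : nat -> R) m :
  \sum_(0 <= i < m) (2 * U i.+1 - U i - U i.+2) * W i.+1 =
  \sum_(0 <= i < m.+1) (U i.+1 - U i) * (W i.+1 - W i)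
  - (U m.+1 - U m) * W m.+1 + (U 1%N - U 0%N) * W 0%N.
Proof.
elim: m => [|m IH]; first by rewrite big_nil big_nat1; ring.
by rewrite big_nat_recr//= IH [in RHS]big_nat_recr//=; ring.
Qed.

(** Each square occurs in two differences and [(a - b)^2 <= 2 a^2 + 2 b^2]. The negative last term
    records that [d m] has been used only once, which carries the induction. *)
Lemma sum_sqr_diff_le (R : realDomainType) (d : nat -> R) m :
  \sum_(0 <= i < m) (d i.+1 - d i) ^+ 2 <=
  4 * (\sum_(0 <= i < m.+1) d i ^+ 2) - 2 * d m ^+ 2.
Proof.
elim: m => [|m IH].
  by rewrite big_nil big_nat1; have := sqr_ge0 (d 0%N); lra.
rewrite big_nat_recr//= [in leRHS]big_nat_recr//=.
have : 0 <= (d m.+1 + d m) ^+ 2 by exact: sqr_ge0.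
move: IH; set S := \sum_(0 <= _ < _) _; set S' := \sum_(0 <= _ < _) _; nra.
Qed.

Lemma unitmx_inj (F : fieldType) m (A : 'M[F]_m) :
  (forall u : 'rV_m, u *m A = 0 -> u = 0) -> A \in unitmx.
Proof.
move=> inj; rewrite -row_free_unit -kermx_eq0; apply/eqP/row_matrixP => i.
by rewrite row0; apply: inj; rewrite -row_mul mulmx_ker row0.
Qed.

(** * Stiffness and averaging matrices on the interior nodes *)

Section StiffnessMatrix.
Variables (R : realType) (m : nat) (h : R).
Implicit Types u w : 'rV[R]_m.

(** With [M = m.+1] there are [m] interior unknowns and [m.+2] nodes. The two [unlift] strip the
    first and the last node, where the value is 0. *)
Definition extend0 u : 'rV[R]_m.+2 :=
  \row_i (if unlift ord0 i is Some j then
            (if unlift ord_max j is Some l then u 0 l else 0) else 0).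

Fact extend0_is_linear : linear extend0.
Proof.
move=> c u w; apply/rowP => i; rewrite !mxE.
by case: unliftP => [j _|_]; [case: unliftP => [l _|_]|];
  rewrite ?mxE ?mulr0 ?addr0.
Qed.
HB.instance Definition _ :=
  GRing.isLinear.Build R 'rV[R]_m 'rV[R]_m.+2 _ extend0 extend0_is_linear.

Lemma extend00 u : extend0 u 0 ord0 = 0.
Proof. by rewrite mxE unlift_none. Qed.

Lemma extend0_max u : extend0 u 0 ord_max = 0.
Proof.
rewrite mxE (_ : ord_max = lift ord0 ord_max) ?liftK ?unlift_none//.
exact: ord_inj.
Qed.

Definition inner_node (j : 'I_m) : 'I_m.+2 := lift ord0 (lift ord_max j).

Lemma inner_nodeE (j : 'I_m) : inner_node j = j.+1 :> nat.
Proof. by rewrite /inner_node lift0/= /bump leqNgt ltn_ord add0n. Qed.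

Lemma extend0_inner u j : extend0 u 0 (inner_node j) = u 0 j.
Proof. by rewrite mxE !liftK. Qed.

Lemma interior_nodeP (i : 'I_m.+2) :
  @interior_node m.+1 i -> exists j, i = inner_node j.
Proof.
rewrite /interior_node subn1/= => /andP[i0 im].
have ltim : (i.-1 < m)%N by case: (nat_of_ord i) i0 im.
by exists (Ordinal ltim); apply: ord_inj; rewrite inner_nodeE/= prednK.
Qed.

Lemma interior_inner j : @interior_node m.+1 (inner_node j).
Proof. by rewrite /interior_node inner_nodeE subn1/= ltn_ord. Qed.

Definition restrict0 (z : 'rV[R]_m.+2) : 'rV[R]_m := \row_j z 0 (inner_node j).

Lemma restrict0K (z : 'rV[R]_m.+2) : @zero_boundary R m.+1 z -> extend0 (restrict0 z) = z.
Proof.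
move=> [z0 z1]; apply/rowP => i; rewrite mxE.
case: unliftP => [j ->|->]; last by rewrite z0.
case: unliftP => [l ->|->]; first by rewrite mxE.
by rewrite (_ : lift ord0 ord_max = ord_max) ?z1//; exact: ord_inj.
Qed.

Lemma zero_boundary_extend0 u : @zero_boundary R m.+1 (extend0 u).
Proof. by split; [exact: extend00|exact: extend0_max]. Qed.

Let neg_delta2x u : 'rV[R]_m :=
  \row_j (- @delta2x R m.+1 h (extend0 u) (inner_node j)).

Fact neg_delta2x_is_linear : linear neg_delta2x.
Proof.
move=> c u w; apply/rowP => j.
have delta2xP (z z' : 'rV[R]_m.+2) i : @delta2x R m.+1 h (c *: z + z') i
    = c * @delta2x R m.+1 h z i + @delta2x R m.+1 h z' i.
  by rewrite /delta2x !mxE; ring.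
by rewrite mxE extend0_is_linear delta2xP !mxE; ring.
Qed.
HB.instance Definition _ :=
  GRing.isLinear.Build R 'rV[R]_m 'rV[R]_m _ neg_delta2x neg_delta2x_is_linear.

Definition stiffness : 'M[R]_m := lin1_mx neg_delta2x.

Lemma stiffnessE u j :
  (u *m stiffness) 0 j = - @delta2x R m.+1 h (extend0 u) (inner_node j).
Proof. by rewrite mul_rV_lin1 mxE. Qed.

Let val_at u (k : nat) : R := extend0 u 0 (inord k).

Let val_at0 u : val_at u 0 = 0.
Proof. by rewrite /val_at (_ : inord 0 = ord0) ?extend00//; apply: ord_inj; rewrite /= inordK. Qed.

Let val_atm u : val_at u m.+1 = 0.
Proof. by rewrite /val_at (_ : inord m.+1 = ord_max) ?extend0_max//; apply: ord_inj; rewrite /= inordK. Qed.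

Let val_at_inner u (j : 'I_m) : val_at u j.+1 = u 0 j.
Proof.
rewrite /val_at (_ : inord j.+1 = inner_node j) ?extend0_inner//.
by apply: ord_inj; rewrite inner_nodeE inordK// !ltnS ltnW.
Qed.

Let stiffness_val u (j : 'I_m) : (u *m stiffness) 0 j =
  (2 * val_at u j.+1 - val_at u j - val_at u j.+2) / h ^+ 2.
Proof.
rewrite stiffnessE /delta2x inner_nodeE/= val_at_inner -extend0_inner.
rewrite -/(val_at u j) -/(val_at u j.+2); ring.
Qed.

(** Discrete Green identity. Symmetry, the upper bound and invertibility of the stiffness matrix are
    all read off from it. *)
Lemma dot_stiffness u w : dot (u *m stiffness) w =
  (\sum_(0 <= i < m.+1) (val_at u i.+1 - val_at u i)
                      * (val_at w i.+1 - val_at w i)) / h ^+ 2.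
Proof.
have := sum_parts (val_at u) (val_at w) m.
rewrite (val_at0 w) (val_atm w) !mulr0 subr0 addr0 => <-.
rewrite dotE big_mkord mulr_suml; apply: eq_bigr => j _.
by rewrite stiffness_val !val_at_inner mulrAC.
Qed.

Lemma trmx_stiffness : stiffness^T = stiffness.
Proof.
have sym u w : dot (u *m stiffness) w = dot (w *m stiffness) u.
  rewrite !dot_stiffness; congr (_ / _).
  by apply: eq_bigr => i _; rewrite mulrC.
have ent i j : dot (delta_mx 0 i *m stiffness) (delta_mx 0 j) = stiffness i j.
  rewrite dotE (bigD1 j)//= big1 ?addr0; last first.
    by move=> l lj; rewrite [delta_mx 0 j _ _]mxE (negbTE lj) mulr0.
  by rewrite -rowE !mxE !eqxx mulr1.
by apply/matrixP => i j; rewrite mxE -!ent sym.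
Qed.

Hypothesis h0 : 0 < h.

(** Up to sign, the entries of [h^2] times [u *m stiffness] are differences of the first differences
    [d], so [sum_sqr_diff_le] compares the two forms. *)
Lemma dot_stiffness_bound u : h ^+ 2 / 4 * dot (u *m stiffness) (u *m stiffness)
  <= dot (u *m stiffness) u.
Proof.
pose d i := val_at u i.+1 - val_at u i.
have := sum_sqr_diff_le d m; have := sqr_ge0 (d m).
have -> : dot (u *m stiffness) (u *m stiffness) =
    (\sum_(0 <= i < m) (d i.+1 - d i) ^+ 2) / h ^+ 4.
  rewrite dotE big_mkord mulr_suml; apply: eq_bigr => j _.
  by rewrite !stiffness_val /d; field; rewrite gt_eqF.
rewrite dot_stiffness; under [X in _ <= X / h ^+ 2]eq_bigr do rewrite -expr2 -/(d _).
set S := \sum_(0 <= _ < _) _; set S' := \sum_(0 <= _ < _) _ => h1 h2.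
have -> : h ^+ 2 / 4 * (S / h ^+ 4) = S / 4 / h ^+ 2 by field; rewrite gt_eqF.
by rewrite ler_pM2r ?invr_gt0 ?exprn_gt0//; lra.
Qed.

Lemma stiffness_unit : stiffness \in unitmx.
Proof.
apply: unitmx_inj => u u0; have := dot_stiffness u u.
rewrite u0 dot0l => /esym/eqP.
rewrite mulf_eq0 invr_eq0 expf_eq0/= (gt_eqF h0) orbF => /eqP.
rewrite big_mkord => /psumr_eq0P hd.
have d0 i : (i <= m)%N -> val_at u i.+1 = val_at u i.
  move=> im; apply/eqP; rewrite -subr_eq0 -[_ == 0]orbb -mulf_eq0; apply/eqP.
  have im' : (i < m.+1)%N by [].
  by apply: (hd _ (Ordinal im')) => // j _; rewrite -expr2 sqr_ge0.
have v0 i : (i <= m.+1)%N -> val_at u i = 0.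
  by elim: i => [_|i IH im]; [exact: val_at0|rewrite d0// IH// ltnW].
by apply/rowP => j; rewrite -val_at_inner v0 ?mxE// ltnS ltnW.
Qed.

Definition averaging : 'M[R]_m := 1%:M - (h ^+ 2 / 12) *: stiffness.

Lemma averagingE u j :
  (u *m averaging) 0 j = @compact_avg R m.+1 (extend0 u) (inner_node j).
Proof.
rewrite /compact_avg interior_inner /averaging mulmxBr mulmx1 -scalemxAr.
rewrite [LHS]mxE [X in _ + X]mxE [X in - X]mxE stiffnessE /delta2x -extend0_inner.
by field; rewrite gt_eqF.
Qed.

End StiffnessMatrix.

(** * The discrete Caputo derivative *)

Lemma subrACA (V : zmodType) (x y z w : V) :
  (x - y) - (z - w) = (x - z) - (y - w).
Proof. by rewrite !opprB addrACA [RHS]addrACA [- y - z]addrC. Qed.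

Lemma powR_tangent_le (R : realType) (p x y : R) : 0 < p < 1 -> 0 < y < x ->
  p * (x - y) * x `^ (p - 1) <= x `^ p - y `^ p.
Proof.
move=> /andP[p0 p1] /andP[y0 yx].
have D (z : R) : 0 < z -> is_derive z 1 (fun x : R => x `^ p) (p * z `^ (p - 1)).
  exact: is_derive1_powR.
have [||c] := @MVT R (fun x : R => x `^ p) (fun z => p * z `^ (p - 1)) y x yx.
- by move=> z; rewrite in_itv/= => /andP[yz _]; apply: D; exact: lt_trans yz.
- apply: derivable_within_continuous => z; rewrite in_itv/= => /andP[yz _].
  by have [] := D z (lt_le_trans y0 yz).
rewrite in_itv/= => /andP[yc cx] ->.
rewrite mulrAC ler_wpM2r ?subr_ge0 ?(ltW yx)// ler_wpM2l ?(ltW p0)//.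
rewrite -[p - 1]opprB !powRN lef_pV2 ?posrE ?powR_gt0//; last 2 first.
- by rewrite (lt_trans y0).
- by rewrite (lt_trans y0).
apply: ge0_ler_powR; rewrite ?nnegrE ?ltW//; first by rewrite subr_gt0.
- by rewrite (lt_trans y0).
- by rewrite (lt_trans y0).
Qed.

(** The trapezoidal rule underestimates the integral of the concave [z^p] over [y, x]. The gap
    [phi], as a function of the right end, is 0 at [y], and its derivative is [1 + p] times the gap
    in the tangent inequality. *)
Lemma powR_trapezoid_le (R : realType) (p x y : R) : 0 < p < 1 -> 0 < y < x ->
  (1 + p) * ((x - y) * (x `^ p + y `^ p)) <= 2 * (x `^ (1 + p) - y `^ (1 + p)).
Proof.
move=> hp /andP[y0 yx].
have /andP[p0 p1] := hp.
pose phi (z : R) := 2 * z `^ (1 + p) - (1 + p) * ((z - y) * (z `^ p + y `^ p)).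
pose dphi (z : R) := (1 + p) * (z `^ p - y `^ p - p * (z - y) * z `^ (p - 1)).
have D (z : R) : 0 < z -> is_derive z 1 phi (dphi z).
  move=> z0.
  have h1 := is_derive1_powR (1 + p) z0.
  have h2 := is_derive1_powR p z0.
  have e1 : 1 + p - 1 = p by ring.
  rewrite e1 in h1.
  by apply: is_derive_eq; rewrite /dphi /GRing.scale/=; ring.
have [||c] := @MVT R phi dphi y x yx.
- by move=> z; rewrite in_itv/= => /andP[yz _]; apply: D; exact: lt_trans yz.
- apply: derivable_within_continuous => z; rewrite in_itv/= => /andP[yz _].
  by have [] := D z (lt_le_trans y0 yz).
rewrite in_itv/= => /andP[yc cx] e.
have : 0 <= phi x - phi y.
  rewrite e mulr_ge0 ?subr_ge0 ?(ltW yx)// /dphi mulr_ge0//; first by lra.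
  by rewrite subr_ge0 powR_tangent_le// y0.
rewrite /phi subrr mul0r mulr0 subr0; lra.
Qed.

Section CaputoLeadingCoefficient.
Variables (R : realType) (alpha : R) (t : nat -> R).
Implicit Types (V W : lmodType R) (n k : nat).

(** The coefficient of [w n] in the discrete Caputo derivative. The [d_1] term is the summand k = n
    - 1 of the last sum, which contains [nabla w n] with ratio [rho n]. *)
Definition caputo_lead n : R :=
  if n == 1%N then coef_c alpha t 1 0
  else coef_c alpha t n 0 + rho t n / (1 + rho t n) * coef_d alpha t n 0
       + coef_d alpha t n 1 / (rho t n * (1 + rho t n)).

(** A sequence without history isolates the leading coefficient. Together with [caputoB] this splits
    off the past and yields dependence on levels up to [n] only, with no further expansion of the
    sums. *)
Lemma caputo_supp V (z : nat -> V) n : (0 < n)%N ->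
  (forall k, (k < n)%N -> z k = 0) ->
  caputo alpha t z n = caputo_lead n *: z n.
Proof.
move=> n0 hz; rewrite /caputo /caputo_lead.
have [n1|n1] := eqVneq n 1%N; first by rewrite n1 in hz *; rewrite /nabla (hz 1.-1)// subr0.
case: n n0 n1 hz => [//|[//|n]] _ _ hz.
have nab k : (k < n.+2)%N -> nabla z k = 0.
  by move=> kn; rewrite /nabla !hz ?subr0//; case: k kn => // k /ltnW.
have nabn : nabla z n.+2 = z n.+2 by rewrite /nabla/= (hz n.+1)// subr0.
rewrite big_nat_recr//= big_nat big1; last first.
  by move=> k /andP[_ kn]; rewrite nab// scaler0.
rewrite big_nat_recr//= [X in _ + (X + _)]big_nat [X in _ + (X + _)]big1; last first.
  by move=> k /andP[_ kn]; rewrite !nab// ?scaler0 ?subr0 ?scaler0// ltnW.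
rewrite !add0r nabn nab// !scaler0 !subr0 subnn subSnn.
by rewrite -!scalerDl.
Qed.

Lemma caputoB V (w z : nat -> V) n :
  caputo alpha t (fun k => w k - z k) n = caputo alpha t w n - caputo alpha t z n.
Proof.
have nabB k : nabla (fun k => w k - z k) k = nabla w k - nabla z k.
  by rewrite /nabla subrACA.
rewrite /caputo; case: ifP => _; first by rewrite nabB scalerBr.
have comb (c r : R) (x y x' y' : V) :
    c *: ((x - x') - r *: (y - y')) = c *: (x - r *: y) - c *: (x' - r *: y').
  by rewrite -[RHS]scalerBr (scalerBr r) subrACA.
rewrite (eq_bigr (fun k => coef_c alpha t n (n - k) *: nabla w k
    - coef_c alpha t n (n - k) *: nabla z k)); last first.
  by move=> k _; rewrite nabB scalerBr.
rewrite [X in _ + _ + X](eq_bigr (fun k =>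
    (coef_d alpha t n (n - k) / (rho t k.+1 * (1 + rho t k.+1)))
      *: (nabla w k.+1 - rho t k.+1 *: nabla w k)
  - (coef_d alpha t n (n - k) / (rho t k.+1 * (1 + rho t k.+1)))
      *: (nabla z k.+1 - rho t k.+1 *: nabla z k))); last first.
  by move=> k _; rewrite !nabB comb.
rewrite !sumrB !nabB comb.
by rewrite !opprD [RHS]addrACA [X in _ = X + _]addrACA.
Qed.

Lemma caputo_linear V W (f : {linear V -> W}) (w : nat -> V) n :
  caputo alpha t (fun k => f (w k)) n = f (caputo alpha t w n).
Proof.
have nabf k : nabla (fun k => f (w k)) k = f (nabla w k) by rewrite /nabla linearB.
rewrite /caputo; case: ifP => _; first by rewrite nabf linearZ.
have fcomb (c r : R) (x y : V) :
    f (c *: (x - r *: y)) = c *: (f x - r *: f y).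
  by rewrite linearZ/= linearB/= linearZ.
rewrite [RHS]linearD [X in _ = X + _]linearD/=; congr (_ + _ + _).
- by rewrite [RHS]linear_sum; apply: eq_bigr => k _; rewrite nabf [RHS]linearZ.
- by rewrite !nabf fcomb.
- by rewrite [RHS]linear_sum; apply: eq_bigr => k _; rewrite !nabf fcomb.
Qed.

Lemma eq_caputo V (w z : nat -> V) n : (0 < n)%N ->
  (forall k, (k <= n)%N -> w k = z k) -> caputo alpha t w n = caputo alpha t z n.
Proof.
move=> n0 wz; apply/eqP; rewrite -subr_eq0 -caputoB caputo_supp//.
  by rewrite wz// subrr scaler0.
by move=> k kn; rewrite wz ?subrr// ltnW.
Qed.

Hypothesis halpha : 0 < alpha < 1.

Let G2 : 0 < Gamma (2 - alpha).
Proof. by case/andP: halpha => a0 a1; apply: Gamma_gt0; lra. Qed.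

Let G3 : Gamma (3 - alpha) = (2 - alpha) * Gamma (2 - alpha).
Proof.
case/andP: halpha => a0 a1; rewrite -Gamma_succ; try lra.
by congr Gamma; ring.
Qed.

(** With [A] and [B] the distances from the current time to the ends of the preceding step, the
    coefficient is a positive multiple of the trapezoidal gap for exponent [1 - alpha] on [B, A]. *)
Lemma coef_d1_ge0 n : t n < t n.+1 -> t n.+1 < t n.+2 -> 0 <= coef_d alpha t n.+2 1.
Proof.
have /andP[a0 a1] := halpha.
have ? := G2.
move=> tn tn1; rewrite /coef_d subSS subn0 /= /tau /=.
set A := t n.+2 - t n; set B := t n.+2 - t n.+1.
have -> : t n.+1 - t n = A - B by rewrite /A /B; ring.
have AB : 0 < B < A by rewrite /A /B; lra.
have hp : 0 < 1 - alpha < 1 by lra.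
have := powR_trapezoid_le hp AB.
have -> : 1 + (1 - alpha) = 2 - alpha by ring.
set c1 := A `^ _; set b1 := B `^ _; set a2 := A `^ _; set b2 := B `^ _ => h.
have d0 : 0 < A - B by lra.
rewrite G3 (_ : _ - _ = (2 * (a2 - b2) - (2 - alpha) * ((A - B) * (c1 + b1)))
    / ((A - B) ^+ 2 * ((2 - alpha) * Gamma (2 - alpha)))); last first.
  field; rewrite !gt_eqF//; lra.
by rewrite divr_ge0 ?subr_ge0// ltW// !mulr_gt0 ?exprn_gt0//; lra.
Qed.

(* The left-hand side is [caputo_lead] without its nonnegative [d_1] term,
   simplified through [d_0 = alpha / (2 - alpha) * c_0]. *)
Lemma caputo_lead_ge n : t n < t n.+1 -> ((0 < n)%N -> t n.-1 < t n) ->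
  ((0 < n)%N -> 1 <= rho t n.+1) ->
  (2 - alpha + 2 * rho t n.+1)
    / ((1 + rho t n.+1) * Gamma (3 - alpha) * tau t n.+1 `^ alpha)
  <= caputo_lead n.+1.
Proof.
have /andP[a0 a1] := halpha.
have ? := G2.
move=> tn tn1 rn; have T0 : 0 < tau t n.+1 by rewrite /tau subr_gt0.
have X0 := powR_gt0 alpha T0.
have p1 : tau t n.+1 `^ (1 - alpha) = tau t n.+1 / tau t n.+1 `^ alpha.
  by rewrite powRB ?(gt_eqF T0) ?implybT// powRr1// ltW.
have p2 : tau t n.+1 `^ (2 - alpha) = tau t n.+1 ^+ 2 / tau t n.+1 `^ alpha.
  rewrite powRB; last by rewrite (gt_eqF T0) implybT.
  by rewrite (@powR_mulrn R _ 2) ?ltW.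
have c0 : coef_c alpha t n.+1 0 = (tau t n.+1 `^ alpha * Gamma (2 - alpha))^-1.
  rewrite /coef_c subn0 /= -/(tau t n.+1) subrr powR0 ?subr_eq0; last by lra.
  by rewrite p1; field; rewrite !gt_eqF.
have d0 : coef_d alpha t n.+1 0 =
    2 / (tau t n.+1 `^ alpha * Gamma (3 - alpha))
    - (tau t n.+1 `^ alpha * Gamma (2 - alpha))^-1.
  rewrite /coef_d subn0 /= subrr !powR0 ?subr_eq0; [|lra|lra].
  rewrite -[t n.+1 - t n]/(tau t n.+1) p1 p2 G3; field; rewrite !gt_eqF//; lra.
have a2 : 0 < 2 - alpha by lra.
rewrite /caputo_lead; case: n => [|n] in tn tn1 rn T0 X0 p1 p2 c0 d0 *.
  (* At the first level the convention [rho 1 = 0] turns the bound into the value of [c_0]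
     itself. *)
  rewrite /= c0 G3 [rho t 1]/rho/= le_eqVlt; apply/orP; left; apply/eqP.
  by field; rewrite !gt_eqF//; lra.
rewrite (_ : n.+2 == 1%N = false)// c0 d0.
have r1 := rn isT; have d1 := coef_d1_ge0 (tn1 isT) tn.
set r := rho t n.+2 in r1 *.
have h : 0 <= coef_d alpha t n.+2 1 / (r * (1 + r)).
  by rewrite divr_ge0// mulr_ge0; lra.
rewrite -[leLHS]addr0; apply: lerD => //.
rewrite G3 le_eqVlt; apply/orP; left; apply/eqP.
by field; rewrite !gt_eqF//; lra.
Qed.

End CaputoLeadingCoefficient.

(** * Solving the scheme level by level *)

Section SpatialStep.
Variables (R : realType) (m : nat) (h kappa eps beta : R).
Hypotheses (h0 : 0 < h) (kappa0 : 0 < kappa).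
Hypothesis hbeta : kappa <= beta * (h ^+ 2 / 12).
Implicit Types u v g w : 'rV[R]_m.

Let L := stiffness m h.
Let A := averaging m h.
Let K := invmx L.
Let c := h ^+ 2 / 12.
Let ke := kappa * eps ^+ 2.

Let c0 : 0 < c. Proof. by rewrite divr_gt0// exprn_gt0. Qed.

Let AE : A = 1%:M - c *: L. Proof. by []. Qed.

Let LA : L *m A = A *m L.
Proof. by rewrite AE mulmxBr mulmxBl mulmx1 mul1mx -scalemxAl -scalemxAr. Qed.

Let Asym : A^T = A.
Proof. by rewrite AE linearB/= linearZ/= trmx_stiffness trmx1. Qed.

(** Here [L^2 <= (4/h^2) L] contributes [3 c] and subtracting [c L] from the identity costs [c]. It
    serves three times: on the kernel of [A] for invertibility, at [w *m K] to bound [A K] below by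
    [2 c], and at [w *m invmx A] for nonnegativity of [L A^-1]. *)
Let dot_averaging_stiffness w :
  2 * c * dot (w *m L) (w *m L) <= dot (w *m A) (w *m L).
Proof.
have := dot_stiffness_bound h0 w; rewrite -/L (dotC _ w).
have -> : h ^+ 2 / 4 = 3 * c by rewrite /c; field.
rewrite AE mulmxBr mulmx1 -scalemxAr dotBl dotZl; lra.
Qed.

Let Lunit : L \in unitmx. Proof. exact: stiffness_unit. Qed.

Lemma averaging_unit : A \in unitmx.
Proof.
apply: unitmx_inj => w w0; have := dot_averaging_stiffness w.
rewrite w0 dot0l => h1.
have {h1} wL0 : w *m L = 0.
  apply: dot_eq0; apply/eqP; rewrite eq_le dot_ge0 andbT.
  have := c0; have := dot_ge0 (w *m L); nra.
by rewrite -(mulmxK Lunit w) wL0 mul0mx.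
Qed.

Let P := beta *: (A *m K) - kappa%:M + ke *: (L *m invmx A).

Let AK : A *m K = K *m A.
Proof.
by rewrite -[LHS](mulKmx Lunit) (mulmxA L) LA -(mulmxA A) mulmxV// mulmx1.
Qed.

Let LAV : L *m invmx A = invmx A *m L.
Proof.
rewrite -[LHS](mulKmx averaging_unit) (mulmxA A) -LA -(mulmxA L).
by rewrite mulmxV ?averaging_unit// mulmx1.
Qed.

Let Psym : P^T = P.
Proof.
rewrite /P linearD/= linearB/= !linearZ/= tr_scalar_mx !trmx_mul !trmx_inv.
by rewrite Asym trmx_stiffness -AK -LAV.
Qed.

Let Ppos w : 0 <= dot (w *m P) w.
Proof.
rewrite /P mulmxDr mulmxBr -!scalemxAr mul_mx_scalar dotDl dotBl !dotZl.
have h1 : 2 * c * dot w w <= dot (w *m (A *m K)) w.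
  have := dot_averaging_stiffness (w *m K).
  by rewrite mulmxKV// AK mulmxA.
have h2 : 0 <= dot (w *m (L *m invmx A)) w.
  have := dot_averaging_stiffness (w *m invmx A).
  rewrite mulmxKV ?averaging_unit// LAV mulmxA (dotC w); apply: le_trans.
  by rewrite mulr_ge0 ?dot_ge0// mulr_ge0// ltW.
have h3 : 0 <= ke by rewrite /ke mulr_ge0 ?sqr_ge0// ltW.
have h4 : 0 <= ke * dot (w *m (L *m invmx A)) w by rewrite mulr_ge0.
have beta0 : 0 <= beta.
  by rewrite -(pmulr_lge0 _ c0); apply: le_trans hbeta; exact: ltW.
have h5 : beta * (2 * c * dot w w) <= beta * dot (w *m (A *m K)) w.
  by rewrite ler_wpM2l.
have h6 : kappa * dot w w <= beta * c * dot w w by rewrite ler_wpM2r ?dot_ge0.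
have h7 : 0 <= kappa * dot w w by rewrite mulr_ge0 ?dot_ge0// ltW.
lra.
Qed.

(** One time level in interior unknowns: [beta *: u - g] stands for the discrete Caputo derivative,
    [g] carrying the history. *)
Definition scheme_step g u v : Prop :=
  (beta *: u - g) *m A = - (kappa *: ((cube u - u) *m L)) - ke *: (v *m L)
  /\ v *m A = u *m L.

Let scheme_stepE g u v : scheme_step g u v <->
  u *m P + kappa *: cube u = g *m (A *m K) /\ v = u *m (L *m invmx A).
Proof.
have vE : v *m A = u *m L <-> v = u *m (L *m invmx A).
  split=> [e|->]; first by rewrite mulmxA -e mulmxK ?averaging_unit.
  by rewrite -!mulmxA mulVmx ?averaging_unit// mulmx1.
have alg (a b d q r : 'rV[R]_m) : a - b = - (q - d) - r <-> a - d + r + q = b.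
  by split=> /rowP e; apply/rowP => i; have := e i; rewrite !mxE; lra.
have KE (y z : 'rV[R]_m) : y = z *m L <-> y *m K = z.
  by split=> [->|<-]; rewrite ?mulmxK ?mulmxKV.
rewrite /scheme_step vE !scalemxAl -mulNmx -mulmxBl KE.
rewrite mulmxBl mulmxBl -!scalemxAl -!mulmxA scalerBr.
rewrite /P mulmxDr mulmxBr -!scalemxAr mul_mx_scalar.
by split=> -[e ev]; subst v; split=> //; exact/alg.
Qed.

Lemma scheme_step_ex g : exists u v, scheme_step g u v.
Proof.
have [u hu] := cubic_system_ex (g *m (A *m K)) Psym Ppos kappa0.
by exists u, (u *m (L *m invmx A)); apply/scheme_stepE.
Qed.

Lemma scheme_step_uniq g u v u' v' :
  scheme_step g u v -> scheme_step g u' v' -> u = u' /\ v = v'.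
Proof.
move=> /scheme_stepE[hu ->] /scheme_stepE[hu' ->].
by have -> := cubic_system_inj Ppos kappa0 hu hu'.
Qed.

End SpatialStep.

(** * Time marching with memory *)

Section Scheme.
Variables (R : realType) (m : nat) (alpha kappa eps a b : R) (t : nat -> R).
Implicit Types x y : nat -> 'rV[R]_m.

Let h : R := mesh_step m.+1 a b.

(** The history is obtained by cutting the sequence off at level [n], which avoids collecting
    coefficients; the sign makes it the right-hand side [g] of [scheme_step]. *)
Definition caputo_past x n : 'rV[R]_m :=
  - caputo alpha t (fun k => if (k < n)%N then x k else 0) n.

Lemma caputo_pastE x n : (0 < n)%N ->
  caputo alpha t x n = caputo_lead alpha t n *: x n - caputo_past x n.
Proof.
move=> n0; rewrite /caputo_past opprK; apply/eqP; rewrite -subr_eq -caputoB.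
rewrite caputo_supp//; first by rewrite ltnn subr0.
by move=> k kn; rewrite kn subrr.
Qed.

Lemma eq_caputo_past x x' n : (0 < n)%N -> (forall k, (k < n)%N -> x k = x' k) ->
  caputo_past x n = caputo_past x' n.
Proof.
move=> n0 xx'; congr (- _); apply: eq_caputo => // k _.
by case: ifP => // /xx'.
Qed.

Definition level_eq x y n : Prop :=
  scheme_step h kappa eps (caputo_lead alpha t n) (caputo_past x n) (x n) (y n).

(** Extension by zero commutes with the Caputo derivative by linearity and with the nonlinearity
    because [f_CH] is 0 at 0. The memory is why [u] must agree on all levels up to [n], but [v] only
    at [n]. *)
Lemma level_eqP (u v : nat -> 'rV[R]_m.+2) x y n : 0 < h -> (0 < n)%N ->
  (forall k, (k <= n)%N -> u k = extend0 (x k)) -> v n = extend0 (y n) ->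
  level_eq x y n <->
  (forall i, @interior_node m.+1 i ->
     @compact_avg R m.+1 (caputo alpha t u n) i
     = kappa * @delta2x R m.+1 h (map_mx (@f_CH R) (u n)) i
       + kappa * eps ^+ 2 * @delta2x R m.+1 h (v n) i) /\
  (forall i, @interior_node m.+1 i ->
     @compact_avg R m.+1 (v n) i = - @delta2x R m.+1 h (u n) i).
Proof.
move=> hn0 n0 ux vy.
rewrite (eq_caputo alpha t n0 ux) caputo_linear ux// vy.
have -> : map_mx (@f_CH R) (extend0 (x n)) = extend0 (cube (x n) - x n).
  apply/rowP => i; rewrite !mxE.
  case: unliftP => [j _|_]; last by rewrite /f_CH expr0n subr0.
  case: unliftP => [l _|_]; last by rewrite /f_CH expr0n subr0.
  by rewrite !mxE.
rewrite /level_eq /scheme_step -caputo_pastE//.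
have sc (k l : R) (p q : 'rV[R]_m) j :
    (- (k *: p) - l *: q) 0 j = - (k * p 0 j) - l * q 0 j by rewrite !mxE.
have nod (Q : 'I_m.+2 -> Prop) : (forall i, @interior_node m.+1 i -> Q i) <->
    (forall j, Q (inner_node j)).
  split=> [hQ j|hQ i /interior_nodeP[j ->]//]; exact/hQ/interior_inner.
rewrite !nod; split=> -[e1 e2]; split.
- move=> j; rewrite -(averagingE hn0) e1 sc !stiffnessE.
  by rewrite !mulrN !opprK.
- by move=> j; rewrite -(averagingE hn0) e2 stiffnessE.
- apply/rowP => j; rewrite (averagingE hn0) e1 sc !stiffnessE.
  by rewrite !mulrN !opprK.
- by apply/rowP => j; rewrite (averagingE hn0) e2 stiffnessE.
Qed.

Hypotheses (hpos : 0 < h) (kappa0 : 0 < kappa).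
Variable N : nat.
Hypothesis hlead : forall n, (1 <= n <= N)%N ->
  kappa <= caputo_lead alpha t n * (h ^+ 2 / 12).

Lemma levels_ex (x0 : 'rV[R]_m) : exists x y, x 0%N = x0 /\
  forall n, (1 <= n <= N)%N -> level_eq x y n.
Proof.
(* Entries beyond level [K] are placeholders: equations up to [K] never read them, so overwriting
   entry [K.+1] preserves the levels already solved. *)
suff : forall K, (K <= N)%N -> exists x y, x 0%N = x0 /\
    forall n, (1 <= n <= K)%N -> level_eq x y n by apply.
elim=> [_|K IH KN].
  by exists (fun=> x0), (fun=> x0); split=> // -[].
have [x [y [xx0 hxy]]] := IH (ltnW KN).
have [u [v huv]] := scheme_step_ex eps hpos kappa0 (hlead (KN : (1 <= K.+1 <= N)%N))
  (caputo_past x K.+1).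
exists (fun k => if k == K.+1 then u else x k), (fun k => if k == K.+1 then v else y k).
split=> // n /andP[n1]; rewrite leq_eqVlt => /predU1P[->|nK].
  rewrite /level_eq eqxx (@eq_caputo_past _ x)// => k kK.
  by rewrite (ltn_eqF kK).
rewrite /level_eq (ltn_eqF nK) (@eq_caputo_past _ x)//.
  by apply: hxy; rewrite n1.
by move=> k kn; rewrite (ltn_eqF (ltn_trans kn nK)).
Qed.

Lemma levels_uniq x y x' y' : x 0%N = x' 0%N ->
  (forall n, (1 <= n <= N)%N -> level_eq x y n) ->
  (forall n, (1 <= n <= N)%N -> level_eq x' y' n) ->
  forall n, (1 <= n <= N)%N -> x n = x' n /\ y n = y' n.
Proof.
move=> xx0 hxy hxy' n; elim/ltn_ind: n => n IH nN.
have /andP[n1 nN'] := nN.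
have past : caputo_past x n = caputo_past x' n.
  apply: eq_caputo_past => // -[//|k] kn.
  by have [] := IH k.+1 kn; rewrite //= (leq_trans (ltnW kn)).
have := hxy' n nN; rewrite /level_eq -past => h'.
exact: (scheme_step_uniq hpos kappa0 (hlead nN) (hxy n nN) h').
Qed.

End Scheme.

Lemma le_tau_max (R : realType) (t : nat -> R) N n : (1 <= n <= N)%N ->
  tau t n <= tau_max t N.
Proof.
by move=> /andP[n1 nN]; apply: le_bigmax_seq; rewrite // mem_index_iota n1 ltnS.
Qed.

Theorem theorem4p2 (R : realType) (M N : nat) (alpha kappa eps a b T : R)
    (t : nat -> R) (u0 : R -> R)
    (halpha : 0 < alpha < 1) (hkappa : 0 < kappa) (heps : 0 < eps)
    (hM : (0 < M)%N) (hab : a < b)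
    (hu0 : zero_boundary (mesh_restrict M a b u0))
    (hN : (0 < N)%N) (ht0 : t 0%N = 0) (htN : t N = T)
    (ht : forall k, (1 <= k <= N)%N -> t k.-1 < t k)
    (hrho : forall k, (2 <= k <= N)%N -> 1 <= rho t k)
    (hstep : forall n, (1 <= n <= N)%N ->
      tau_max t N <=
        ((2 - alpha + 2 * rho t n) * mesh_step M a b ^+ 2
         / (12 * kappa * (1 + rho t n) * Gamma (3 - alpha))) `^ (1 / alpha)) :
  exists u v : nat -> 'rV[R]_M.+1,
    scheme_solution N alpha kappa eps a b t u0 u v /\
    (forall u' v' : nat -> 'rV[R]_M.+1,
      scheme_solution N alpha kappa eps a b t u0 u' v' ->
      forall n, (1 <= n <= N)%N -> u' n = u n /\ v' n = v n).
Proof.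
case: M hM hu0 hstep => // m _ hu0 hstep.
have hpos : 0 < mesh_step m.+1 a b by rewrite divr_gt0 ?subr_gt0// ltr0n.
have lead n : (1 <= n <= N)%N ->
    kappa <= caputo_lead alpha t n * (mesh_step m.+1 a b ^+ 2 / 12).
  case: n => [//|n] nN; have /andP[_ nN'] := nN.
  have /andP[al0 al1] := halpha.
  have tn : t n < t n.+1 by exact: (ht n.+1).
  have T0 : 0 < tau t n.+1 by rewrite /tau subr_gt0.
  have hr : 0 <= rho t n.+1.
    case: n nN nN' tn T0 => [|n] nN nN' _ _; first by rewrite /rho eqxx.
    by apply: le_trans (hrho n.+2 _).
  have tn1 : (0 < n)%N -> t n.-1 < t n.
    by move=> n0; apply: ht; rewrite n0 ltnW.
  have rn : (0 < n)%N -> 1 <= rho t n.+1 by move=> n0; apply: hrho; rewrite ltnS n0.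
  have := caputo_lead_ge halpha tn tn1 rn.
  set r := rho t n.+1 in hr *; set beta := caputo_lead _ _ _; set H := mesh_step _ _ _.
  have G3 : 0 < Gamma (3 - alpha) by apply: Gamma_gt0; lra.
  set G := Gamma _ in G3 *.
  (* [X] is the base in the step restriction, which thus reads [tau^alpha <= X]; the lower bound for
     [beta] times [H^2 / 12] equals [kappa * (X / tau^alpha)]. *)
  pose X := (2 - alpha + 2 * r) * H ^+ 2 / (12 * kappa * (1 + r) * G).
  have hX : 0 <= X.
    rewrite divr_ge0// ?mulr_ge0 ?sqr_ge0 ?(ltW hkappa) ?(ltW G3)//; lra.
  have X0 := powR_gt0 alpha T0.
  have tX : tau t n.+1 `^ alpha <= X.
    rewrite -[leRHS](powRr1 hX) -(@mulVf _ alpha) ?gt_eqF// powRrM.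
    apply: ge0_ler_powR; rewrite ?nnegrE ?powR_ge0 ?(ltW al0) ?(ltW T0)//.
    rewrite -[alpha^-1]div1r; apply: le_trans (hstep n.+1 nN).
    exact: le_tau_max.
  move=> hb; have H0 : 0 < H ^+ 2 / 12 by rewrite divr_gt0// exprn_gt0.
  apply: le_trans (ler_wpM2r (ltW H0) hb).
  rewrite (_ : _ / _ * _ = kappa * (X / tau t n.+1 `^ alpha)); last first.
    by rewrite /X; field; rewrite !gt_eqF//; lra.
  by rewrite ler_peMr ?(ltW hkappa)// ler_pdivlMr// mul1r.
have [x [y [xx0 hxy]]] :=
  levels_ex eps hpos hkappa lead (restrict0 (mesh_restrict m.+1 a b u0)).
have lev u v x' y' n := @level_eqP R m alpha kappa eps a b t u v x' y' n hpos.
exists (fun n => extend0 (x n)), (fun n => extend0 (y n)); split.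
  split.
  - by move=> n _; exact: zero_boundary_extend0.
  - by move=> n _; exact: zero_boundary_extend0.
  - by move=> i /interior_nodeP[j ->]; rewrite extend0_inner xx0 !mxE.
  - move=> n i nN; have /andP[n1 _] := nN.
    have [+ _] := (lev _ (fun n => extend0 (y n)) x y n n1 (fun _ _ => erefl) erefl).1 (hxy n nN).
    exact.
  - move=> n i nN; have /andP[n1 _] := nN.
    have [_] := (lev _ (fun n => extend0 (y n)) x y n n1 (fun _ _ => erefl) erefl).1 (hxy n nN).
    exact.
move=> u' v' [zu zv iu eu ev] n nN.
pose x' k := restrict0 (u' k); pose y' k := restrict0 (v' k).
have ux k : (k <= N)%N -> u' k = extend0 (x' k) by move=> kN; rewrite restrict0K//; exact: zu.
have vy k : (1 <= k <= N)%N -> v' k = extend0 (y' k) by move=> kN; rewrite restrict0K//; exact: zv.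
have hxy' k : (1 <= k <= N)%N -> level_eq alpha kappa eps a b t x' y' k.
  move=> kN; have /andP[k1 kN'] := kN.
  apply/(lev u' v') => //; [|exact: vy|].
    by move=> l lk; apply: ux; exact: leq_trans kN'.
  by split=> i; [exact: eu|exact: ev].
(* The scheme prescribes initial values at interior nodes only, and [restrict0] reads no others. *)
have x00 : x' 0%N = x 0%N.
  by rewrite xx0; apply/rowP => j; rewrite !mxE iu ?interior_inner.
have [ex ey] := levels_uniq hpos hkappa lead x00 hxy' hxy nN.
by have /andP[_ nN'] := nN; rewrite ux// vy// ex ey.
Qed.
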